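(* Assume there are a function $M:\mathbf{X}\to[1,\infty)$ and a function $R:T\to(0,1]$ strictly monotonically decreasing to $0$ such that $\|\mathcal{P}_t(x,\cdot)-\Pi\|_{BL(d)}\le M(x)R(t)$ for every $x\in\mathbf{X}$ and $t\in T$, and assume that $(\mathcal{P}_t)_{t\in T}$ is reversible with respect to $\Pi$. Let $p>1$ and let $\nu$ be a probability measure on $\mathbf{X}$ having a Lipschitz density $d\nu/d\Pi$ with respect to $\Pi$. Then for all $t\in T$ large enough, depending on $SFR_{2p}(d\nu/d\Pi)$ (besides $p$ and $R$), $$\chi^2(\nu\mathcal{P}_t\mid\Pi)\le 24\Big(\int_{\mathbf{X}}M\,d\Pi\Big)^{1-\frac{1}{2p}}R(2t)^{1-\frac1p}\Big\|\frac{d\nu}{d\Pi}-1\Big\|_{L_{2p}(\Pi)}^2 .$$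
   Context: $\mathbf{X}$ is a nonempty metric space with metric $d$; all sets, functions and measures are Borel. $T$ is either $[0,\infty)$ or $\mathbb{Z}_+=\{0,1,2,\dots\}$. $(X_t)_{t\in T}$ is a (time-homogeneous) Markov process on $\mathbf{X}$ with transition kernels $\mathcal{P}_t(x,\cdot)=\mathbb{P}(X_t\in\cdot\mid X_0=x)$, which form a Markov semigroup on $L_2(\Pi)$, and $\Pi$ is the unique invariant probability measure, i.e. $\Pi\mathcal{P}_t=\Pi$ for all $t\in T$. Write $\mathcal{P}_tf(x)=\int f(y)\,\mathcal{P}_t(x,dy)$ and $\nu\mathcal{P}_t(\cdot)=\int\mathcal{P}_t(x,\cdot)\,\nu(dx)$. Reversible with respect to $\Pi$ means $\int(\mathcal{P}_tf)g\,d\Pi=\int f(\mathcal{P}_tg)\,d\Pi$ for all bounded $f,g$ and all $t\in T$. In the reversible case the chi-squared divergence is $\chi^2(\nu\mathcal{P}_t\mid\Pi)=\|\mathcal{P}_t(d\nu/d\Pi)-1\|_{L_2(\Pi)}^2$. $\|f\|_\infty=\sup_x|f(x)|$, $\|f\|_{\mathrm{Lip}(d)}=\sup_{x\ne y}|f(y)-f(x)|/d(x,y)$, and $$\|\mathcal{P}_t(x,\cdot)-\Pi\|_{BL(d)}=\sup\Big\{\Big|\mathcal{P}_tf(x)-\int f\,d\Pi\Big|:\|f\|_{\mathrm{Lip}(d)}+\|f\|_\infty\le1\Big\}.$$ The spread to fluctuation ratio of order $p\ge1$ is $SFR_p(f)=\|f-\int f\,d\Pi\|_{L_p(\Pi)}/\|f\|_{\mathrm{Lip}(d)}$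 (for constant $f$ read it as $+\infty$). Inequalities whose right-hand side is $+\infty$ are regarded as trivially true. *)

(* Defs.v *)
From HB Require Import structures.
From mathcomp Require Import all_boot all_order all_algebra.
From mathcomp Require Import all_classical all_reals all_analysis.
From mathcomp Require Import measurable_realfun.

Set Implicit Arguments.
Unset Strict Implicit.
Unset Printing Implicit Defensive.

Import Order.TTheory GRing.Theory Num.Theory.
Import numFieldNormedType.Exports.

Local Open Scope classical_set_scope.
Local Open Scope ring_scope.

HB.mixin Record Measurable_isBorel (d : measure_display) (K : numDomainType) X
    & Measurable d X & Metric K X := {
  borelE : @measurable d X = <<s @open X >>
}.

(* Metric spaces with their Borel sigma-algebra; they are nonempty because
   measurableType inherits from pointedType. *)
#[short(type=borelMetricType)]
HB.structure Definition BorelMetric (d : measure_display) (K : numDomainType) :=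
  { X of Measurable d X & Metric K X & Measurable_isBorel d K X }.

Section norms.
Context {K : realType} {d : measure_display} {X : borelMetricType d K}.
Implicit Types (f : X -> K) (Pi : probability X K).
Local Open Scope ereal_scope.

Definition supnorm f : \bar K := ereal_sup [set `|f x|%:E | x in [set: X]].

(* The maximum with 0 only matters when X is a singleton (empty supremum). *)
Definition lipnorm f : \bar K :=
  maxe 0 (ereal_sup
    [set (`|f z.2 - f z.1| / mdist z.1 z.2)%:E | z in [set z | z.1 != z.2]]).

(* Functions with a finite lipnorm are continuous, so the supremum does range
   over Borel functions. *)
Definition bldist (mu Pi : {measure set X -> \bar K}) : \bar K :=
  ereal_sup [set (`| \int[mu]_x f x - \int[Pi]_x f x |%R)%:E
            | f in [set f | lipnorm f + supnorm f <= 1]].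

Definition sfr Pi (p : K) f : \bar K :=
  if `[< exists c, f = cst c >] then +oo
  else 'N[Pi]_p%:E [(fun x => (f x - (\int[Pi]_y f y)%R)%:E)] / lipnorm f.

End norms.

Section kernels.
Context {K : realType} {d : measure_display} {X : measurableType d}.
Implicit Types (k : K.-pker X ~> X) (nu mu Pi : probability X K).
Local Open Scope ereal_scope.

(* nu k, with k acting on the right on measures *)
Definition kact nu k (A : set X) : \bar K := \int[nu]_x k x A.

Section kact_probability.
Variables (nu : probability X K) (k : K.-pker X ~> X).

Let kact0 : kact nu k set0 = 0.
Proof. by apply: integral0_eq => x _; rewrite measure0. Qed.

Let kact_ge0 A : 0 <= kact nu k A.
Proof. exact: integral_ge0. Qed.

Let kact_sigma_additive : semi_sigma_additive (kact nu k).
Proof.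
move=> U mU tU mUU; rewrite [X in _ --> X](_ : _ =
  \int[nu]_x (\sum_(n <oo) k x (U n))); last first.
  apply: eq_integral => x _.
  by apply/esym/cvg_lim => //; exact/measure_semi_sigma_additive.
apply/cvg_closeP; split.
  by apply: is_cvg_nneseries => n _ _; exact: integral_ge0.
rewrite closeE// integral_nneseries// => n.
exact: measurable_kernel.
Qed.

HB.instance Definition _ :=
  isMeasure.Build _ _ _ (kact nu k) kact0 kact_ge0 kact_sigma_additive.

Let kactT : kact nu k [set: X] = 1.
Proof.
rewrite /kact; under eq_integral do rewrite prob_kernel.
by rewrite integral_cst// mul1e [LHS]probability_setT.
Qed.

HB.instance Definition _ := Measure_isProbability.Build _ _ _ (kact nu k) kactT.

End kact_probability.

Definition kop k (f : X -> K) (x : X) : K := (\int[k x]_y f y)%R.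

Definition has_density nu Pi (h : X -> K) :=
  measurable_fun setT h /\
  forall A, measurable A -> nu A = \int[Pi]_(x in A) (h x)%:E.

Local Open Scope charge_scope.
Definition chi2 mu Pi : \bar K :=
  if `[< mu `<< Pi >] then
    'N[Pi]_2%:E ['d (charge_of_finite_measure mu) '/d Pi \- cst 1] ^+ 2
  else +oo.

End kernels.

Section markov.
Context {K : realType} {d : measure_display} {X : measurableType d}.

Variant is_time_set (T : set K) : Prop :=
| ContinuousTime of T = [set t | 0 <= t]
| DiscreteTime of T = range (fun n : nat => n%:R).

Variables (T : set K) (P : K -> K.-pker X ~> X).
Implicit Types mu Pi : probability X K.

(* Kernels of a time-homogeneous Markov process indexed by T; the values P t
   for t outside T are irrelevant. *)
Record transition_kernels : Prop := {
  transition0 : forall x A, measurable A -> P 0 x A = \d_x A ;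
  chapman_kolmogorov : forall s t x A, T s -> T t -> measurable A ->
    P (s + t) x A = (\int[P s x]_y P t y A)%E }.

(* Positivity and P_t 1 = 1 hold because the P t are probability kernels. *)
Record L2_markov_semigroup Pi : Prop := {
  L2_stable : forall t f, T t ->
    f \in Lfun Pi 2%:E -> kop (P t) f \in Lfun Pi 2%:E ;
  L2_semigroup0 : forall f, f \in Lfun Pi 2%:E -> kop (P 0) f = f %[ae Pi] ;
  L2_semigroupD : forall s t f, T s -> T t -> f \in Lfun Pi 2%:E ->
    kop (P (s + t)) f = kop (P s) (kop (P t) f) %[ae Pi] }.

Definition invariant mu :=
  forall t A, T t -> measurable A -> kact mu (P t) A = mu A.

Definition unique_invariant Pi :=
  invariant Pi /\
  forall mu, invariant mu -> forall A, measurable A -> mu A = Pi A.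

Definition kernel_reversible Pi (k : K.-pker X ~> X) :=
  forall f g : X -> K, measurable_fun setT f -> measurable_fun setT g ->
  [bounded f x | x in setT] -> [bounded g x | x in setT] ->
  \int[Pi]_x (kop k f x * g x) = \int[Pi]_x (f x * kop k g x).

Definition reversible Pi := forall t, T t -> kernel_reversible Pi (P t).

End markov.

Section chi2_reversible.
Context {K : realType} {d : measure_display} {X : measurableType d}.
Variables (nu Pi : probability X K) (k : K.-pker X ~> X).
Hypothesis rev : kernel_reversible Pi k.
Local Open Scope ereal_scope.
Import HBNNSimple.

Let E (u : X -> \bar K) (x : X) : \bar K := \int[k x]_y u y.

Let measurable_E u : (forall x, 0 <= u x) -> measurable_fun [set: X] u ->
  measurable_fun [set: X] (E u).
Proof.
move=> u0 mu.
exact: (measurable_fun_integral_kernel (fun U => @measurable_kernel _ _ _ _ _ k U)).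
Qed.

Let kA_le A x : measurable A -> k x A <= 1.
Proof. by move=> mA; rewrite -(@prob_kernel _ _ _ _ _ k x) le_measure ?inE. Qed.

Let kA_fin A x : measurable A -> k x A \is a fin_num.
Proof.
by move=> mA; rewrite ge0_fin_numE// (le_lt_trans (kA_le x mA))// ltry.
Qed.

Lemma kernel_reversible_nnsfun (A : set X) (u : {nnsfun X >-> K}) :
  measurable A ->
  \int[Pi]_x (k x A * (u x)%:E) = \int[Pi]_(x in A) \int[k x]_y (u y)%:E.
Proof.
move=> mA.
have [C [_ /= uC]] := simple_bounded u.
pose c := (`|C| + 1)%R.
have uc x : (0 <= u x <= c)%R.
  by rewrite fun_ge0/=; apply: le_trans (ler_norm _) (uC c _ x I);
    rewrite (le_lt_trans (ler_norm _))// ltrDl.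
have c0 : (0 <= c)%R by rewrite addr_ge0.
have mu : measurable_fun setT u by [].
have mEu : measurable_fun [set: X] (E (EFin \o u)).
  apply: measurable_E; last exact/measurable_EFinP.
  by move=> x; rewrite lee_fin.
have Eu_ge0 x : 0 <= \int[k x]_y (u y)%:E.
  by apply: integral_ge0 => y _; rewrite lee_fin.
have Eu_le x : \int[k x]_y (u y)%:E <= c%:E.
  apply: (@le_trans _ _ (\int[k x]_y c%:E)).
    apply: ge0_le_integral => //.
    - by move=> y _; rewrite lee_fin.
    - exact/measurable_EFinP.
    - by move=> y _; rewrite lee_fin; case/andP: (uc y).
  by rewrite integral_cst// prob_kernel mule1.
have Eu_fin x : \int[k x]_y (u y)%:E \is a fin_num.
  by rewrite ge0_fin_numE// (le_lt_trans (Eu_le x))// ltry.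
have mkA : measurable_fun setT (k ^~ A) by exact: measurable_kernel.
have int_bnd (f : X -> \bar K) : measurable_fun setT f ->
    (forall x, 0 <= f x <= c%:E) -> \int[Pi]_x f x \is a fin_num.
  move=> mf fc; rewrite ge0_fin_numE; last first.
    by apply: integral_ge0 => x _; case/andP: (fc x).
  apply: (@le_lt_trans _ _ (\int[Pi]_x c%:E)).
    apply: ge0_le_integral => //.
    - by move=> x _; case/andP: (fc x).
    - by move=> x _; case/andP: (fc x).
  by rewrite integral_cst// [X in _ * X]probability_setT mule1 ltry.
have bA : bounded_fun (\1_A : X -> K).
  exists 1%R; split=> // y y1 x _ /=; rewrite indicE.
  by case: (_ \in _); rewrite ?normr1 ?normr0 (le_trans _ (ltW y1)).
have := rev (measurable_indic mA) mu bA (simple_bounded u).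
rewrite /Rintegral => H.
rewrite [RHS]integral_mkcond.
have LE : \int[Pi]_x (k x A * (u x)%:E) =
    \int[Pi]_x (kop k \1_A x * u x)%:E.
  apply: eq_integral => x _; rewrite EFinM; congr (_ * _).
  by rewrite /kop /Rintegral integral_indic// setIT fineK// kA_fin.
have RE : \int[Pi]_x ((fun x => \int[k x]_y (u y)%:E) \_ A) x =
    \int[Pi]_x (\1_A x * kop k u x)%:E.
  apply: eq_integral => x _; rewrite EFinM patchE indicE.
  by case: ifPn => _; rewrite ?mul0e// mul1e /kop /Rintegral fineK.
rewrite LE RE -[LHS]fineK ?H ?fineK//.
- rewrite -RE; apply: int_bnd.
    by apply/(measurable_restrictT _ mA)/measurable_funTS.
  by move=> x; rewrite patchE; case: ifPn => _; rewrite ?lexx ?lee_fin// Eu_ge0 Eu_le.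
- rewrite -LE; apply: int_bnd.
    by apply: emeasurable_funM => //; exact/measurable_EFinP.
  move=> x; case/andP: (uc x) => u0 u1; rewrite mule_ge0//=.
  by rewrite -[c%:E]mul1e lee_pmul// kA_le.
Qed.

Lemma kernel_reversible_ge0 (A : set X) (u : X -> \bar K) :
  measurable A -> measurable_fun setT u -> (forall x, 0 <= u x) ->
  \int[Pi]_x (k x A * u x) = \int[Pi]_(x in A) \int[k x]_y u y.
Proof.
move=> mA mu u0; pose u_ := nnsfun_approx measurableT mu.
have ndu x : {homo (fun n => (u_ n x)%:E) : a b / (a <= b)%N >-> a <= b}.
  by move=> a b ab; rewrite lee_fin; exact/lefP/nd_nnsfun_approx.
have cvu x : (u_ n x)%:E @[n --> \oo] --> u x by exact: cvg_nnsfun_approx.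
have mu_ n : measurable_fun setT (EFin \o u_ n) by exact/measurable_EFinP.
have mkA : measurable_fun setT (k ^~ A) by exact: measurable_kernel.
have cE x : \int[k x]_y (u_ n y)%:E @[n --> \oo] --> \int[k x]_y u y.
  rewrite (_ : \int[k x]_y u y = \int[k x]_y limn (fun n => (u_ n y)%:E)).
    apply: cvg_monotone_convergence => //.
    by move=> n y _; rewrite lee_fin.
  by apply: eq_integral => y _; apply/esym/cvg_lim => //; exact: cvu.
have ndE x : {homo (fun n => \int[k x]_y (u_ n y)%:E) : a b / (a <= b)%N >-> a <= b}.
  move=> a b ab; apply: ge0_le_integral => //.
  - by move=> y _; rewrite lee_fin.
  - exact: mu_.
  - exact: mu_.
  - by move=> y _; exact: ndu.
have mE n : measurable_fun [set: X] (E (EFin \o u_ n)).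
  apply: measurable_E => //.
  by move=> x; rewrite lee_fin.
transitivity (limn (fun n => \int[Pi]_x (k x A * (u_ n x)%:E))).
  rewrite -monotone_convergence//.
  - apply: eq_integral => x _; apply/esym/cvg_lim => //.
    by apply: cvgeZl; [exact: kA_fin|exact: cvu].
  - by move=> n; apply: emeasurable_funM => //; exact: mu_.
  - by move=> n x _; rewrite mule_ge0// lee_fin.
  - by move=> x _ a b ab; rewrite lee_wpmul2l//; exact: ndu.
under eq_fun do rewrite kernel_reversible_nnsfun//.
rewrite -monotone_convergence//.
- by apply: eq_integral => x _; apply/cvg_lim => //; exact: cE.
- by move=> n; apply: measurable_funTS; exact: mE.
- by move=> n x _; apply: integral_ge0 => y _; rewrite lee_fin.
Qed.


Lemma chi2_reversible (h : X -> K) : has_density nu Pi h ->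
  chi2 (kact nu k) Pi = 'N[Pi]_2%:E [(fun x => (kop k h x - 1)%:E)] ^+ 2.
Proof.
move=> [mh hE].
have numu : nu `<< Pi.
  apply/null_content_dominatesP => A mA A0; rewrite hE//.
  by apply: null_set_integral => //; exact/measurable_funTS/measurable_EFinP.
pose u := Radon_Nikodym_SigmaFinite.f nu Pi.
have u0 x : 0 <= u x by exact: Radon_Nikodym_SigmaFinite.f_ge0.
have ui : Pi.-integrable setT u by exact: Radon_Nikodym_SigmaFinite.f_integrable.
have mu : measurable_fun setT u by exact: measurable_int ui.
have uh : ae_eq Pi setT u (EFin \o h).
  apply: integral_ae_eq => //; first exact/measurable_EFinP.
  by move=> A _ mA; rewrite -hE// -Radon_Nikodym_SigmaFinite.f_integral.
have EP A : measurable A -> kact nu k A = \int[Pi]_(x in A) E u x.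
  move=> mA; rewrite -kernel_reversible_ge0//.
  rewrite Radon_Nikodym_SigmaFinite.change_of_variables//.
  exact: measurable_kernel.
have mE : measurable_fun [set: X] (E u) by exact: measurable_E.
have E0 x : 0 <= E u x by exact: integral_ge0.
have iE : Pi.-integrable setT (E u).
  apply/integrableP; split => //; under eq_integral do rewrite gee0_abs//.
  by rewrite -EP// [X in X < _]probability_setT ltry.
have Eh : ae_eq Pi setT (E u) (EFin \o kop k h).
  have [N [mN N0 uhN]] := uh.
  have kN : ae_eq Pi setT (k ^~ N) (cst 0).
    apply/(ae_eq_integral_abs Pi measurableT); first exact: measurable_kernel.
    under eq_integral do rewrite gee0_abs//.
    have -> : \int[Pi]_x k x N = \int[Pi]_x (k x N * cst 1 x).
      by apply: eq_integral => x _; rewrite mule1.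
    rewrite kernel_reversible_ge0//; apply: null_set_integral => //.
    exact/measurable_funTS/measurable_E.
  have Efin := integrable_ae measurableT iE.
  apply: filterS2 kN Efin => x /(_ I) /= kN0 /(_ I) Efin _.
  have Ex : E u x = \int[k x]_y (h y)%:E.
    apply: ae_eq_integral => //; first exact/measurable_EFinP.
    by exists N.
  by rewrite /kop /Rintegral -Ex fineK.
have numuk : kact nu k `<< Pi.
  apply/null_content_dominatesP => A mA A0; rewrite EP//.
  by apply: null_set_integral => //; exact: measurable_funTS.
rewrite /chi2 asboolT//; congr (_ ^+ 2).
set v := Radon_Nikodym _ _.
have vi : Pi.-integrable setT v by exact: Radon_Nikodym_integrable.
have mv : measurable_fun setT v by exact: measurable_int vi.
have vE : ae_eq Pi setT v (E u).
  apply: integral_ae_eq => // A _ mA.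
  by rewrite -EP// -Radon_Nikodym_integral.
have mkh : measurable_fun setT (kop k h).
  apply: measurableT_comp => //.
  rewrite [X in measurable_fun _ X](_ : _ =
      E (EFin \o h)^\+ \- E (EFin \o h)^\-); last first.
    by apply/funext => x; rewrite integralE.
  have mEh := (measurable_EFinP _ _).2 mh.
  apply: emeasurable_funB; apply: measurable_E => //.
  - exact: measurable_funepos.
  - exact: measurable_funeneg.
rewrite unlock; congr (_ `^ _).
apply: ae_eq_integral => //.
- apply: measurableT_comp (measurable_poweR _) _.
  by apply: measurableT_comp => //; exact: emeasurable_funB.
- apply: measurableT_comp (measurable_poweR _) _.
  apply: measurableT_comp => //; apply/measurable_EFinP.
  exact: measurable_funB.
- by apply: filterS2 vE Eh => x /(_ I) vx /(_ I) Ex _; rewrite /= vx Ex.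
Qed.

End chi2_reversible.

(* Main.v *)
Require Import Defs.
From mathcomp Require Import all_boot all_order all_algebra.
From mathcomp Require Import all_classical all_reals all_analysis.
From mathcomp Require Import measurable_realfun lra ring.

Import Order.TTheory GRing.Theory Num.Theory.
Import numFieldNormedType.Exports.

Local Open Scope classical_set_scope.
Local Open Scope ring_scope.

(* Let g = h - 1, s = 2p, N the L_s-norm of g, r = R(2t), I = int M dPi, and let
   g_n be g truncated to [-n, n]. Reversibility gives
   int (P_t g_n)^2 = int g_n P_2t g_n, and Fatou's lemma reduces the theorem to
   bounding the latter for large n. For n >= m it is split as
     g_n P_2t(g_n - g_m) + g_n (P_2t g_m - int g_m) + g_n int g_m.
   The first term is handled by |g_n(x)| |g_n(y) - g_m(y)|
   <= m^(2-s) (|g(x)|^s + |g(y)|^s) and invariance of Pi. For the second, g_m is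
   bounded by m and Lipschitz with the constant of h, so once that constant is
   at most m the factor in parentheses is at most 2m min(M r, 1). The third one
   vanishes in the limit because g is centred. The choice m = N r^(-1/s) balances
   the bounds, and lipnorm h <= m says exactly that r^(1/s) is at most the spread
   to fluctuation ratio. *)

(** * Truncation and elementary pointwise inequalities *)

Definition clamp {K : realType} (m y : K) : K := Num.max (- m) (Num.min y m).

Section clamp.
Context {K : realType}.
Implicit Types m n s x y z : K.

Lemma clamp_id m y : `|y| <= m -> clamp m y = y.
Proof.
by rewrite ler_norml /clamp => /andP[my ym]; rewrite (min_idPl ym) (max_idPr my).
Qed.

Lemma norm_clamp_le m y : 0 <= m -> `|clamp m y| <= m.
Proof.
move=> m0; rewrite ler_norml /clamp le_max lexx/= ge_max ge_min lexx orbT andbT.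
by rewrite (le_trans _ m0)// oppr_le0.
Qed.

Lemma norm_clamp_le_norm m y : 0 <= m -> `|clamp m y| <= `|y|.
Proof.
move=> m0; have [ym|/ltW my] := lerP `|y| m; first by rewrite clamp_id.
exact: le_trans (norm_clamp_le m y m0) my.
Qed.

Lemma clamp_dist_le m y z : 0 <= m -> `|clamp m y - clamp m z| <= `|y - z|.
Proof.
move=> m0; wlog yz : y z / z <= y.
  by move=> H; case: (leP z y) => [/H//|/ltW /H]; rewrite distrC [leRHS]distrC.
rewrite [leRHS]ger0_norm ?subr_ge0// /clamp ler_norml.
by case: (leP y m); case: (leP z m) => zm ym;
  do ?[case: (leP (- m)) => ?]; apply/andP; split; lra.
Qed.

Lemma clampN m y : 0 <= m -> clamp m (- y) = - clamp m y.
Proof.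
rewrite /clamp => m0; case: (leP y m); case: (leP (- y) m) => ? ?;
  do ?[case: (leP (- m)) => ?]; lra.
Qed.

(** By oddness [y] may be taken nonnegative, and then [0 <= clamp m y <= clamp n y <= y]. *)
Lemma clamp_clamp_le m n y : 0 <= m -> m <= n ->
  `|clamp n y - clamp m y| <= `|y|.
Proof.
move=> m0 mn; have n0 := le_trans m0 mn.
wlog y0 : y / 0 <= y.
  move=> H; have [/H//|/ltW y0] := leP 0 y.
  have := H (- y); rewrite oppr_ge0 => /(_ y0).
  by rewrite !clampN// -opprD !normrN.
rewrite /clamp (ger0_norm y0) ler_norml.
by case: (leP y m); case: (leP y n) => ? ?;
  do ?[case: (leP (- n)) => ?]; do ?[case: (leP (- m)) => ?];
  apply/andP; split; lra.
Qed.

(** Write the square as [x^(2-s) * x^s]; as [2 - s <= 0], the first factor is largest at [x = m]. *)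
Lemma sqr_le_powR m s x : 0 < m -> 2 <= s -> m <= x ->
  x * x <= m `^ (2 - s) * x `^ s.
Proof.
move=> m0 s2 mx; have x0 : 0 < x := lt_le_trans m0 mx.
have -> : x `^ s = x `^ 2 * x `^ (s - 2).
  by rewrite -powRD ?(gt_eqF x0) ?implybT// subrKC.
rewrite powR_mulrn ?(ltW x0)// expr2 mulrCA ler_peMr ?mulr_ge0 ?(ltW x0)//.
rewrite -(opprB s 2) powRN mulrC ler_pdivlMr ?powR_gt0// mul1r.
by rewrite ge0_ler_powR ?nnegrE ?subr_ge0 ?(ltW x0) ?(ltW m0).
Qed.

(* The larger of |x| and |y| bounds the product by its square and, being at
   least m, is within the range where z^2 <= m^(2-s) z^s. *)
Lemma clamp_cross_le m n s x y : 0 < m -> m <= n -> 2 <= s ->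
  `|clamp n x| * `|clamp n y - clamp m y| <=
  m `^ (2 - s) * (`|x| `^ s + `|y| `^ s).
Proof.
move=> m0 mn s2; have n0 := le_trans (ltW m0) mn.
have [ym|/ltW my] := lerP `|y| m.
  rewrite !(clamp_id _ y)// ?(le_trans ym)// subrr normr0 mulr0.
  by rewrite mulr_ge0 ?addr_ge0 ?powR_ge0.
have H1 := clamp_clamp_le m n y (ltW m0) mn.
have H2 := norm_clamp_le_norm n x n0.
have [xy|/ltW yx] := lerP `|x| `|y|.
  apply: (@le_trans _ _ (`|y| * `|y|)).
    by rewrite ler_pM// (le_trans H2).
  apply: le_trans (sqr_le_powR m s _ m0 s2 my) _.
  by rewrite ler_wpM2l ?powR_ge0// lerDr powR_ge0.
apply: (@le_trans _ _ (`|x| * `|x|)).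
  by rewrite ler_pM// (le_trans H1).
apply: le_trans (sqr_le_powR m s _ m0 s2 (le_trans my yx)) _.
by rewrite ler_wpM2l ?powR_ge0// lerDl powR_ge0.
Qed.

(* Elementary form of Young's inequality, splitting at a = c. *)
Lemma mul_min1_le c s a b : 0 < c -> 1 <= s -> 0 <= a -> 0 <= b ->
  a * Num.min b 1 <= c * b + c `^ (1 - s) * a `^ s.
Proof.
move=> c0 s1 a0 b0; have [ac|/ltW ca] := leP a c.
  apply: (@le_trans _ _ (c * b)); last by rewrite lerDl mulr_ge0 ?powR_ge0.
  by rewrite ler_pM// ?le_min ?b0 ?ler01// ge_min lexx.
apply: (@le_trans _ _ a).
  by rewrite ler_piMr// ge_min lexx orbT.
have a_gt0 := lt_le_trans c0 ca.
apply: (@le_trans _ _ (c `^ (1 - s) * a `^ s)); last first.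
  by rewrite lerDr mulr_ge0 ?(ltW c0).
have -> : a `^ s = a `^ 1 * a `^ (s - 1).
  by rewrite -powRD ?(gt_eqF a_gt0) ?implybT// subrKC.
rewrite powRr1// mulrCA ler_peMr// -(opprB s 1) powRN mulrC ler_pdivlMr ?powR_gt0// mul1r.
by rewrite ge0_ler_powR ?nnegrE ?subr_ge0 ?(ltW c0).
Qed.

Lemma measurable_clamp d (X : measurableType d) m (f : X -> K) :
  measurable_fun setT f -> measurable_fun setT (clamp m \o f).
Proof.
move=> mf; apply: measurable_maxr; first exact: measurable_cst.
by apply: measurable_minr => //; exact: measurable_cst.
Qed.

End clamp.

(** * Bounded functions, kernel operators and invariance *)

Section bounded.
Context {K : realType} {d : measure_display} {X : measurableType d}.
Implicit Types (k : K.-pker X ~> X) (mu : probability X K) (f g : X -> K).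

Lemma norm_bounded f c : (forall x, `|f x| <= c) -> [bounded f x | x in setT].
Proof.
move=> fc; exists c; split; first exact: num_real.
by move=> y cy x _; exact: le_trans (fc x) (ltW cy).
Qed.

(** Mass one is a hypothesis rather than part of the type of [mu], so that the kernel measures [k x]
    are covered as well as [Pi]. *)
Lemma bounded_integrable (mu : measure X K) f c : mu setT = 1%E ->
  measurable_fun setT f -> (forall x, `|f x| <= c) ->
  mu.-integrable setT (EFin \o f).
Proof.
move=> mu1 mf fc; apply: measurable_bounded_integrable => //.
- by change (mu setT < +oo)%E; rewrite mu1 ltry.
- exact: norm_bounded fc.
Qed.

Lemma norm_Rintegral_le (mu : measure X K) f c : mu setT = 1%E ->
  measurable_fun setT f -> (forall x, `|f x| <= c) ->
  `|\int[mu]_x f x| <= c.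
Proof.
move=> mu1 mf fc.
have ifn := bounded_integrable mu f c mu1 mf fc.
apply: le_trans (le_normr_Rintegral measurableT ifn) _.
apply: (@le_trans _ _ (\int[mu]_x c)); last first.
  by rewrite Rintegral_cst// mu1 mulr1.
apply: le_Rintegral => //.
- exact: integrable_norm ifn.
- by apply: (bounded_integrable mu (cst c) `|c|).
Qed.

Lemma kernel_setT k x : k x setT = 1%E. Proof. exact: prob_kernel. Qed.

Lemma norm_kop_le k f c : measurable_fun setT f -> (forall x, `|f x| <= c) ->
  forall x, `|kop k f x| <= c.
Proof. by move=> mf fc x; apply: norm_Rintegral_le => //; exact: kernel_setT. Qed.

Lemma measurable_kernel_integral k (u : X -> \bar K) : (forall x, 0 <= u x)%E ->
  measurable_fun setT u -> measurable_fun setT (fun x => \int[k x]_y u y)%E.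
Proof.
move=> u0 mu.
exact: (measurable_fun_integral_kernel (fun U => @measurable_kernel _ _ _ _ _ k U)).
Qed.

Lemma measurable_kop k f : measurable_fun setT f -> measurable_fun setT (kop k f).
Proof.
move=> mf; apply: measurableT_comp => //.
(* The integrals of the positive and negative parts are each measurable in [x]. *)
rewrite [X in measurable_fun _ X](_ : _ = (fun x => \int[k x]_y (EFin \o f)^\+ y) \-
  (fun x => \int[k x]_y (EFin \o f)^\- y))%E; last first.
  by apply/funext => x; rewrite integralE.
have mEf := (measurable_EFinP _ _).2 mf.
apply: emeasurable_funB; apply: measurable_kernel_integral => //.
- exact: measurable_funepos.
- exact: measurable_funeneg.
Qed.

(** Reversibility tested against the constant 1 is the invariance of [Pi]. With extended real values
    it can serve to prove integrability. *)
Lemma reversible_invariant_ge0 (Pi : probability X K) k (u : X -> \bar K) :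
  kernel_reversible Pi k -> measurable_fun setT u -> (forall x, 0 <= u x)%E ->
  (\int[Pi]_x \int[k x]_y u y = \int[Pi]_x u x)%E.
Proof.
move=> rev mu u0; rewrite -(kernel_reversible_ge0 rev measurableT mu u0).
by apply: eq_integral => x _; rewrite [k x setT]kernel_setT mul1e.
Qed.

End bounded.

(** * Passage from truncated functions to the limit *)

Section fatou.
Context {K : realType} {d : measure_display} {X : measurableType d}.
Variables (Pi : probability X K) (k k2 : K.-pker X ~> X).
Hypothesis rev : kernel_reversible Pi k.

(** Here [k] is the kernel at time t and [k2] the one at time 2t. Reversibility, available for
    bounded functions, moves one factor [k] across and leaves [kop k (kop k f)], which is [kop k2 f]
    almost everywhere. *)
Lemma integral_sqr_kop (f : X -> K) c :
  measurable_fun setT f -> (forall x, `|f x| <= c) ->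
  kop k2 f = kop k (kop k f) %[ae Pi] ->
  (\int[Pi]_x (kop k f x ^+ 2)%:E = (\int[Pi]_x (f x * kop k2 f x))%R%:E)%E.
Proof.
move=> mf fc k2E; have Pi1 : Pi setT = 1%E by exact: probability_setT.
have mkf := measurable_kop k f mf.
have bf := norm_bounded f c fc.
have bkf := norm_bounded _ _ (norm_kop_le k f c mf fc).
have ib (u v : X -> K) a b : measurable_fun setT u -> measurable_fun setT v ->
    (forall x, `|u x| <= a) -> (forall x, `|v x| <= b) ->
    Pi.-integrable setT (EFin \o (fun x => u x * v x)).
  move=> mu mv ua vb; apply: (bounded_integrable Pi _ (a * b)) => //.
    exact: measurable_funM.
  by move=> x; rewrite normrM ler_pM.
transitivity ((\int[Pi]_x (kop k f x * kop k f x))%R%:E)%E.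
  rewrite /Rintegral fineK; last first.
    apply: (integrable_fin_num measurableT).
    by apply: (ib _ _ c c) => //; exact: norm_kop_le.
  by apply: eq_integral => x _; rewrite expr2.
congr EFin; rewrite (rev _ _ mf mkf bf bkf) /Rintegral; congr fine.
apply: ae_eq_integral => //.
- by apply/measurable_EFinP; apply: measurable_funM => //; exact: measurable_kop.
- by apply/measurable_EFinP; apply: measurable_funM => //; exact: measurable_kop.
- by apply: filterS k2E => x /= -> .
Qed.

(** Dominated convergence with bound [|g|]; it serves for [Pi] and for the measures [k x]. *)
Lemma Rintegral_clamp_cvg (mu : measure X K) (g : X -> K) :
  mu.-integrable setT (EFin \o g) ->
  \int[mu]_x clamp n%:R (g x) @[n --> \oo] --> \int[mu]_x g x.
Proof.
move=> ig; have mg := (measurable_EFinP _ _).1 (measurable_int _ ig).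
apply: fine_cvg; rewrite fineK; last exact: (integrable_fin_num measurableT ig).
apply: (@dominated_cvg _ _ _ _ _ _ _ _ (fun y => `|(g y)%:E|%E)) => //.
- move=> n; apply/measurable_EFinP; exact: measurable_clamp.
- move=> y _; apply: cvg_near_cst; near=> n; congr EFin; apply: clamp_id.
  by near: n; exact: nbhs_infty_ger.
- exact: integrable_abse.
- by move=> n y _; rewrite lee_fin norm_clamp_le_norm.
Unshelve. all: by end_near. Qed.

(** By invariance the function sending [x] to the [k x]-integral of [|g|] has a finite
    [Pi]-integral, so it is finite almost everywhere. *)
Lemma ae_kernel_integrable (g : X -> K) : Pi.-integrable setT (EFin \o g) ->
  {ae Pi, forall x, (k x).-integrable setT (EFin \o g)}.
Proof.
move=> ig; have mEg := measurable_int _ ig.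
have iEg : Pi.-integrable setT (fun x => \int[k x]_y `|(g y)%:E|)%E.
  apply/integrableP; split.
    by apply: measurable_kernel_integral => //; exact: measurableT_comp.
  under eq_integral do rewrite gee0_abs ?integral_ge0//.
  rewrite reversible_invariant_ge0//; first by case/integrableP : ig.
  exact: measurableT_comp.
apply: filterS (integrable_ae measurableT iEg) => x /(_ I) fx.
by apply/integrableP; split => //; rewrite -ge0_fin_numE// integral_ge0.
Qed.

(** At almost every [x] the function [g] is integrable for [k x], so [kop k g x] is the limit of its
    truncated versions. Fatou's lemma then carries the bounds [b n] to their limit. *)
Lemma integral_sqr_kop_le (g : X -> K) (b : nat -> K) B :
  Pi.-integrable setT (EFin \o g) ->
  (\forall n \near \oo,
    (\int[Pi]_x (kop k (clamp n%:R \o g) x ^+ 2)%:E <= (b n)%:E)%E) ->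
  b @ \oo --> B ->
  (\int[Pi]_x (kop k g x ^+ 2)%:E <= B%:E)%E.
Proof.
move=> ig gb bB; have mg := (measurable_EFinP _ _).1 (measurable_int _ ig).
have mh n : measurable_fun setT (fun x => (kop k (clamp n%:R \o g) x ^+ 2)%:E).
  apply/measurable_EFinP; apply: measurable_funX; apply: measurable_kop.
  exact: measurable_clamp.
have mkg : measurable_fun setT (fun x => (kop k g x ^+ 2)%:E).
  by apply/measurable_EFinP; apply: measurable_funX; exact: measurable_kop.
rewrite (@ae_eq_integral _ _ _ Pi setT
  (fun x => limn_einf (fun n => (kop k (clamp n%:R \o g) x ^+ 2)%:E)))//.
- apply: le_trans (fatou Pi measurableT mh _) _.
    by move=> n x _; rewrite lee_fin sqr_ge0.
  have bBE : (b n)%:E @[n --> \oo] --> B%:E by apply: cvg_EFin => //; exact: nearW.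
  rewrite limn_einf_lim -(cvg_lim (@ereal_hausdorff K) bBE).
  apply: lee_lim; [exact: is_cvg_einfs|by apply/cvg_ex; exists B%:E|].
  by apply: filterS gb => n; apply: le_trans; apply: ereal_inf_lbound; exists n => /=.
(* The lower limit is measurable as minus the upper limit of the negatives. *)
- rewrite [X in measurable_fun _ X](_ : _ = (fun x => - limn_esup
    (fun n => - (kop k (clamp n%:R \o g) x ^+ 2)%:E)))%E; last first.
    apply/funext => x; rewrite -limn_einfN; congr limn_einf.
    by apply/funext => n /=; rewrite opprK.
  apply: measurableT_comp => //; apply: measurable_fun_limn_esup => n.
  exact: measurableT_comp.
- apply: filterS (ae_kernel_integrable g ig) => x /Rintegral_clamp_cvg kx _; apply/esym.
  apply: (cvg_limn_einf_sup _).1; apply: cvg_EFin; first exact: nearW.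
  rewrite expr2; under eq_fun do rewrite expr2. exact: cvgM.
Qed.

End fatou.

(** * The quadratic form of the truncated function *)

Section dirichlet.
Context {K : realType} {d : measure_display} {X : measurableType d}.
Variables (Pi : probability X K) (k : K.-pker X ~> X).

(** Integrate [clamp_cross_le] over [y] against [k x], a measure of mass one. *)
Lemma clamp_kop_dist_le (g : X -> K) m n s x : measurable_fun setT g ->
  0 < m -> m <= n -> 2 <= s ->
  ((`|clamp n (g x)| * `|kop k (clamp n \o g) x - kop k (clamp m \o g) x|)%:E
   <= (m `^ (2 - s))%:E *
      ((`|g x| `^ s)%:E + \int[k x]_y (`|g y| `^ s)%:E))%E.
Proof.
move=> mg m0 mn s2; have n0 := le_trans (ltW m0) mn.
have kx1 := kernel_setT k x.
have mc a := measurable_clamp d X a g mg.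
have ic a : 0 <= a -> (k x).-integrable setT (EFin \o (clamp a \o g)).
  move=> a0; apply: (bounded_integrable (k x) _ a) => // y.
  exact: norm_clamp_le.
have mp : measurable_fun setT (fun y => (`|g y| `^ s)%:E).
  apply/measurable_EFinP.
  apply: (measurableT_comp (measurable_powR _)).
  exact: measurableT_comp.
have mD : measurable_fun setT (fun y => `|clamp n (g y) - clamp m (g y)|).
  by apply: measurableT_comp => //; apply: measurable_funB; exact: mc.
have iD : (k x).-integrable setT (EFin \o (fun y => clamp n (g y) - clamp m (g y))).
  apply: (bounded_integrable (k x) _ (n + m)) => //.
    by apply: measurable_funB; exact: mc.
  by move=> y; rewrite (le_trans (ler_normB _ _))// lerD ?norm_clamp_le// ltW.
rewrite /kop -RintegralB ?ic// ?(ltW m0)// EFinM EFin_normr_Rintegral//.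
apply: (@le_trans _ _ (`|clamp n (g x)|%:E *
    \int[k x]_y `|clamp n (g y) - clamp m (g y)|%:E))%E.
  rewrite lee_wpmul2l ?lee_fin//.
  by apply: le_trans (le_abse_integral _ measurableT (measurable_int _ iD)) _.
rewrite -ge0_integralZl_EFin//; last exact/measurable_EFinP.
apply: (@le_trans _ _ (\int[k x]_y
    ((m `^ (2 - s))%:E * ((`|g x| `^ s)%:E + (`|g y| `^ s)%:E)))%E).
  apply: ge0_le_integral => //.
  - by apply: emeasurable_funM => //; exact/measurable_EFinP.
  - by apply: emeasurable_funM => //; exact: emeasurable_funD.
  - by move=> y _; rewrite lee_fin; exact: clamp_cross_le.
rewrite ge0_integralZl_EFin ?powR_ge0//; last 2 first.
- by move=> y _; rewrite adde_ge0// lee_fin powR_ge0.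
- exact: emeasurable_funD.
rewrite lee_wpmul2l ?lee_fin ?powR_ge0// ge0_integralD//.
by rewrite integral_cst// kx1 mule1.
Qed.

(** Applied with [k] the kernel at time 2t. The three summands of the bound match the three terms of
    the splitting; [n] occurs only in the last one. The parameter [c] comes from [mul_min1_le] and
    stays free until the bounds are balanced. *)
Lemma dirichlet_clamp_le (g M : X -> K) m n s r c :
  kernel_reversible Pi k -> measurable_fun setT g -> measurable_fun setT M ->
  0 < m -> m <= n -> 2 <= s -> 0 <= r -> 0 < c -> (forall x, 0 <= M x) ->
  (forall x, `|kop k (clamp m \o g) x - \int[Pi]_y clamp m (g y)| <=
     2 * m * Num.min (M x * r) 1) ->
  ((\int[Pi]_x (clamp n (g x) * kop k (clamp n \o g) x))%R%:E <=
    (m `^ (2 - s))%:E *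
      (\int[Pi]_x (`|g x| `^ s)%:E + \int[Pi]_x (`|g x| `^ s)%:E)
    + (2 * m)%:E * ((c * r)%:E * \int[Pi]_x (M x)%:E
      + (c `^ (1 - s))%:E * \int[Pi]_x (`|g x| `^ s)%:E)
    + (m * `|\int[Pi]_x clamp n (g x)|%R)%:E)%E.
Proof.
move=> rev mg mM m0 mn s2 r0 c0 M0 HM; have n0 := le_trans (ltW m0) mn.
have Pi1 : Pi setT = 1%E by exact: probability_setT.
have mc a := measurable_clamp d X a g mg.
have gb a x : 0 <= a -> `|clamp a (g x)| <= a by exact: norm_clamp_le.
have ic a : 0 <= a -> Pi.-integrable setT (EFin \o (clamp a \o g)).
  by move=> a0; apply: (bounded_integrable Pi _ a) => // y; exact: gb.
have mp : measurable_fun setT (fun y => (`|g y| `^ s)%:E).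
  apply/measurable_EFinP.
  apply: (measurableT_comp (measurable_powR _)).
  exact: measurableT_comp.
have p0 x : (0 <= (`|g x| `^ s)%:E)%E by rewrite lee_fin powR_ge0.
set a := Rintegral Pi _ (fun y => clamp m (g y)) in HM *.
have ma : `|a| <= m.
  by apply: norm_Rintegral_le => [//||x]; [exact: mc|apply: gb; exact: ltW].
(* [F] gathers the first two terms of the splitting; the third is [a] times the integral of
   [clamp n (g x)]. *)
pose F x := clamp n (g x) * (kop k (clamp n \o g) x - a).
have mF : measurable_fun setT F.
  apply: measurable_funM; first exact: mc.
  by apply: measurable_funB => //; apply: measurable_kop; exact: mc.
have iF : Pi.-integrable setT (EFin \o F).
  apply: (bounded_integrable Pi _ (n * (n + m))) => // x.
  rewrite normrM ler_pM ?gb// (le_trans (ler_normB _ _))// lerD//.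
  by apply: norm_kop_le; [exact: mc|move=> y; exact: gb].
have -> : (\int[Pi]_x (clamp n (g x) * kop k (clamp n \o g) x) =
    \int[Pi]_x F x + a * \int[Pi]_x clamp n (g x))%R.
  rewrite -RintegralZl ?ic// -RintegralD//; last first.
    apply: (bounded_integrable Pi _ (m * n)) => [//||x].
      by apply: measurable_funM => //; exact: mc.
    by rewrite normrM ler_pM// gb.
  by congr fine; apply: eq_integral => x _; rewrite /F; congr EFin; ring.
rewrite EFinD; apply: leeD; last first.
  by rewrite lee_fin (le_trans (ler_norm _))// normrM ler_wpM2r.
apply: (@le_trans _ _ `|(\int[Pi]_x F x)%R|%:E); first by rewrite lee_fin ler_norm.
rewrite EFin_normr_Rintegral//.
apply: le_trans (le_abse_integral _ measurableT _) _; first exact/measurable_EFinP.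
(* Weighted by [|clamp n (g x)|], the error of replacing [clamp n] by [clamp m] under the kernel is
   at most [W], and the deviation of [kop k (clamp m \o g)] from [a] is at most [V]. *)
pose W x := ((m `^ (2 - s))%:E *
      ((`|g x| `^ s)%:E + \int[k x]_y (`|g y| `^ s)%:E))%E.
pose V x := ((2 * m)%:E *
  ((c * r)%:E * (M x)%:E + (c `^ (1 - s))%:E * (`|g x| `^ s)%:E))%E.
have mk : measurable_fun setT (fun x => \int[k x]_y (`|g y| `^ s)%:E)%E.
  exact: measurable_kernel_integral.
have k0 x : (0 <= \int[k x]_y (`|g y| `^ s)%:E)%E by exact: integral_ge0.
have mW : measurable_fun setT W.
  by apply: emeasurable_funM => //; exact: emeasurable_funD.
have mEM : measurable_fun setT (EFin \o M) by exact/measurable_EFinP.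
have mV1 : measurable_fun setT (fun x => (c * r)%:E * (M x)%:E)%E.
  exact: emeasurable_funM.
have mV2 : measurable_fun setT (fun x => (c `^ (1 - s))%:E * (`|g x| `^ s)%:E)%E.
  exact: emeasurable_funM.
have mV : measurable_fun setT V.
  by apply: emeasurable_funM => //; exact: emeasurable_funD.
have W0 x : (0 <= W x)%E.
  by apply: mule_ge0; [rewrite lee_fin powR_ge0|apply: adde_ge0].
have V1 x : (0 <= (c * r)%:E * (M x)%:E)%E.
  by rewrite mule_ge0 ?lee_fin ?mulr_ge0 ?(ltW c0).
have V2 x : (0 <= (c `^ (1 - s))%:E * (`|g x| `^ s)%:E)%E.
  by rewrite mule_ge0// lee_fin powR_ge0.
have m20 : 0 <= 2 * m by rewrite mulr_ge0 ?(ltW m0).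
have V0 x : (0 <= V x)%E by rewrite mule_ge0 ?adde_ge0.
apply: (@le_trans _ _ (\int[Pi]_x (W x + V x))%E).
  apply: ge0_le_integral => //.
  - by apply/measurable_EFinP; exact: measurableT_comp.
  - exact: emeasurable_funD.
  move=> x _; apply: (@le_trans _ _ ((`|clamp n (g x)| *
      `|kop k (clamp n \o g) x - kop k (clamp m \o g) x|)%:E +
      (`|clamp n (g x)| * `|kop k (clamp m \o g) x - a|)%:E)%E).
    rewrite -EFinD lee_fin /F normrM -mulrDr ler_wpM2l//.
    by rewrite (le_trans _ (ler_normD _ _))// addrA subrK.
  apply: leeD; first exact: clamp_kop_dist_le.
  rewrite [V x](_ : _ =
    (2 * m * (c * r * M x + c `^ (1 - s) * `|g x| `^ s))%:E)// lee_fin.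
  apply: (@le_trans _ _ (`|g x| * (2 * m * Num.min (M x * r) 1))).
    by rewrite ler_pM// norm_clamp_le_norm.
  rewrite mulrCA ler_wpM2l// -mulrA (mulrC r).
  by apply: mul_min1_le; rewrite ?mulr_ge0// (le_trans _ s2)// ler1n.
rewrite ge0_integralD//; apply: leeD.
  rewrite /W ge0_integralZl_EFin ?powR_ge0//; last 2 first.
  - by move=> x _; rewrite adde_ge0.
  - exact: emeasurable_funD.
  rewrite ge0_integralD//.
  (* Invariance turns the kernel average of [|g|^s] into a second copy of its [Pi]-integral. *)
  by rewrite (reversible_invariant_ge0 Pi k _ rev).
rewrite /V ge0_integralZl_EFin//; last 2 first.
- by move=> x _; rewrite adde_ge0.
- exact: emeasurable_funD.
rewrite ge0_integralD// !ge0_integralZl_EFin ?powR_ge0// ?mulr_ge0 ?(ltW c0)//.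
by move=> x _; rewrite lee_fin.
Qed.

End dirichlet.

(** * Lipschitz functions and the bounded Lipschitz distance *)

Section lipschitz.
Context {K : realType} {d : measure_display} {X : borelMetricType d K}.
Implicit Types (f g : X -> K) (mu nu : {measure set X -> \bar K}).

Lemma lipnorm_leP f (l : K) : 0 <= l ->
  (lipnorm f <= l%:E)%E <-> (forall x y, `|f y - f x| <= l * mdist x y).
Proof.
move=> l0; rewrite /lipnorm ge_max lee_fin l0 /=; split.
  move=> fl x y; have [->|xy] := eqVneq x y.
    by rewrite subrr normr0 mdistxx mulr0.
  rewrite -ler_pdivrMr ?mdist_gt0// -lee_fin; apply: le_trans fl.
  by apply: ereal_sup_ubound; exists (x, y).
move=> fl; apply: ge_ereal_sup => _ [[x y] /= xy <-].
by rewrite lee_fin ler_pdivrMr ?mdist_gt0.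
Qed.

Lemma supnorm_le f c : (forall x, `|f x| <= c) -> (supnorm f <= c%:E)%E.
Proof. by move=> fc; apply: ge_ereal_sup => _ [x _ <-]; rewrite lee_fin. Qed.

Lemma lipnorm_ge0 f : (0 <= lipnorm f)%E.
Proof. by rewrite /lipnorm le_max lexx. Qed.

Lemma lipnormB f c : lipnorm (fun x => f x - c) = lipnorm f.
Proof.
rewrite /lipnorm; congr (maxe 0 (ereal_sup _))%E.
by apply/seteqP; split => _ [z zE <-]; exists z => //; congr (`|_| / _)%:E; ring.
Qed.

(** Divided by [l + m], the truncation of [g] is an admissible test function, which gives the bound
    [(l + m) * r <= 2 * m * r]. The bound [2 * m] holds because the truncation has absolute value at
    most [m]. *)
Lemma clamp_bldist_le mu nu g (l m r : K) :
  mu setT = 1%E -> nu setT = 1%E -> measurable_fun setT g ->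
  (lipnorm g <= l%:E)%E -> l <= m -> 0 < m -> (bldist mu nu <= r%:E)%E ->
  `|\int[mu]_x clamp m (g x) - \int[nu]_x clamp m (g x)|
    <= 2 * m * Num.min r 1.
Proof.
move=> mu1 nu1 mg gl lm m0 bl.
have l0 : 0 <= l by rewrite -lee_fin; exact: le_trans (lipnorm_ge0 g) gl.
have mc := measurable_clamp d X m g mg.
have cm x : `|clamp m (g x)| <= m by apply: norm_clamp_le; exact: ltW.
have imu := bounded_integrable mu _ m mu1 mc cm.
have inu := bounded_integrable nu _ m nu1 mc cm.
rewrite minr_pMr ?mulr_ge0 ?(ltW m0)// le_min; apply/andP; split; last first.
  rewrite mulr1 (le_trans (ler_normB _ _))// mulr_natl mulr2n lerD//;
  exact: norm_Rintegral_le.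
have lm0 : 0 < l + m by rewrite ltr_wpDl.
(* The zero function is a test function, so the distance is nonnegative. *)
have r0 : 0 <= r.
  rewrite -lee_fin; apply: le_trans bl; apply: ereal_sup_ubound => /=.
  exists (cst 0) => /=; last by rewrite !Rintegral_cst// !mul0r subrr normr0.
  rewrite -[leRHS]add0e leeD//.
    by apply/lipnorm_leP => // x y; rewrite subrr normr0 mul0r.
  by apply: supnorm_le => x; rewrite normr0.
pose f x := (l + m)^-1 * clamp m (g x).
have fbl : (lipnorm f + supnorm f <= 1)%E.
  apply: (@le_trans _ _ ((l / (l + m))%:E + (m / (l + m))%:E)%E); last first.
    by rewrite -EFinD -mulrDl divff ?gt_eqF.
  apply: leeD.
    apply/lipnorm_leP; first by rewrite divr_ge0// ltW.
    move=> x y; rewrite /f -mulrBr normrM gtr0_norm ?invr_gt0//.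
    rewrite (mulrC l) -mulrA ler_pM2l ?invr_gt0//.
    apply: le_trans (clamp_dist_le m _ _ (ltW m0)) _.
    by move: x y; apply/lipnorm_leP.
  apply: supnorm_le => x; rewrite /f normrM gtr0_norm ?invr_gt0//.
  by rewrite mulrC ler_pM2r ?invr_gt0.
have := le_trans (ereal_sup_ubound (ex_intro2 _ _ f fbl erefl)) bl.
rewrite lee_fin /f !RintegralZl// -mulrBr normrM gtr0_norm ?invr_gt0//.
rewrite mulrC ler_pdivrMr// => /le_trans; apply.
by rewrite mulrC ler_wpM2r//; lra.
Qed.

End lipschitz.

(** * Balancing the parameters *)

(* c is chosen so that c r I = c^(1-s) N^s, and m so that
   m^(2-s) N^s = r^(1-2/s) N^2. *)
Lemma powR_balance {K : realType} (N r I s m c : K) :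
  0 < N -> 0 < r -> 1 <= I -> 1 <= s ->
  m = N * r `^ (- s^-1) -> c = N * (r * I) `^ (- s^-1) ->
  m `^ (2 - s) * (N `^ s + N `^ s) +
    2 * m * (c * r * I + c `^ (1 - s) * N `^ s) <=
  24 * I `^ (1 - s^-1) * r `^ (1 - 2 * s^-1) * N ^+ 2.
Proof.
move=> N0 r0 I1 s1 mE cE; have s0 : 0 < s := lt_le_trans ltr01 s1.
have s_neq0 : s != 0 by rewrite gt_eqF.
have I0 : 0 < I := lt_le_trans ltr01 I1.
(* Written with exponentials, the identities between powers become identities between exponents,
   rational in [s], that [field] decides. *)
have [[a Na] [b rb] [e Ie]] : [/\ exists a, N = expR a, exists b, r = expR b &
    exists2 e, I = expR e & 0 <= e].
  split; [by exists (ln N); rewrite lnK|by exists (ln r); rewrite lnK|].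
  by exists (ln I); [rewrite lnK|exact: ln_ge0].
move=> e0.
pose w := I `^ (1 - s^-1); pose z := r `^ (1 - 2 * s^-1) * N ^+ 2.
have e1 : m `^ (2 - s) * N `^ s = z.
  rewrite /z mE Na rb -powR_mulrn ?expR_ge0// -!expRM -!expRD -!expRM -!expRD.
  by congr expR; field.
have e2 : m * (c * r * I) = w * z.
  rewrite /w /z mE cE Na rb Ie -powR_mulrn ?expR_ge0//.
  rewrite -!expRM -!expRD -!expRM -!expRD.
  by congr expR; field.
have e3 : m * (c `^ (1 - s) * N `^ s) = w * z.
  rewrite /w /z mE cE Na rb Ie -powR_mulrn ?expR_ge0//.
  rewrite -!expRM -!expRD -!expRM -!expRD -!expRM -!expRD.
  by congr expR; field.
have z0 : 0 <= z by rewrite mulr_ge0 ?powR_ge0 ?sqr_ge0.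
have w1 : z <= w * z.
  rewrite ler_peMl// /w Ie -expRM -expR0 ler_expR mulr_ge0//.
  by rewrite subr_ge0 expR0 invf_le1.
have -> : 24 * I `^ (1 - s^-1) * r `^ (1 - 2 * s^-1) * N ^+ 2 = 24 * (w * z).
  by rewrite !mulrA.
(* The left side equals [2 * z + 4 * (w * z)], which is at most [6 * (w * z)] because
   [z <= w * z]. *)
rewrite mulrDr e1 -[2 * m * _]mulrA mulrDr e2 e3.
by move: (w * z) (z) z0 w1 => wz z' z0 w1; lra.
Qed.

(** * Times and the threshold *)

Lemma time_set_ge0 {K : realType} (T : set K) t : is_time_set T -> T t -> 0 <= t.
Proof. by case=> -> // [n _ <-]. Qed.

Lemma time_set_double {K : realType} (T : set K) t :
  is_time_set T -> T t -> T (2 * t).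
Proof.
case=> -> /=; first by move=> t0; rewrite mulr_ge0.
by move=> [n _ <-]; exists (2 * n)%N => //; rewrite natrM.
Qed.

(** For real [v > 0] the claim holds once [R (2 * t) < v^(1/u)], hence for large [t]. Later [v] is
    the spread to fluctuation ratio and [u] is [1/(2p)]. *)
Lemma rate_threshold {K : realType} (T : set K) (R : K -> K) (u : K) (v : \bar K) :
  is_time_set T -> (forall t, T t -> 0 < R t <= 1) ->
  R @ within T (pinfty_nbhs K) --> (0 : K) -> 0 < u ->
  exists t0, forall t, T t -> t0 <= t -> (0 < v)%E ->
    ((R (2 * t) `^ u)%:E <= v)%E.
Proof.
move=> HT R01 R0 u0; case: v => [v| |].
- have [v0|v0] := leP v 0.
    by exists 0 => t _ _; rewrite lte_fin ltNge v0.
  (* Beyond some [A] the rate is below [v^(1/u)], and [t >= |A| + 1] ensures [2 * t > A]. *)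
  have := @cvgr_dist_lt _ _ _ _ _ _ _ R0 _ (powR_gt0 u^-1 v0).
  move=> [A [_ HA]]; exists (`|A| + 1) => t Tt tA _.
  have T2 := time_set_double T t HT Tt.
  have t0 := time_set_ge0 T t HT Tt.
  have : A < 2 * t.
    by have := ler_norm A; have := normr_ge0 A; lra.
  move=> /HA /(_ T2); have /andP[R2 _] := R01 _ T2.
  rewrite sub0r normrN gtr0_norm// lee_fin => Rv.
  have -> : v = (v `^ u^-1) `^ u.
    by rewrite -powRrM mulVf ?gt_eqF// powRr1 ?ltW.
  by rewrite ge0_ler_powR ?nnegrE ?powR_ge0 ?(ltW R2) ?(ltW u0) ?(ltW Rv).
- by exists 0 => t _ _ _; rewrite leey.
- by exists 0.
Qed.

Lemma poweR2_sqre {K : realType} (x : \bar K) : (0 <= x)%E -> (x `^ 2 = x ^+ 2)%E.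
Proof.
case: x => [x x0| _|//]; first by rewrite poweR_EFin powR_mulrn// EFin_expe.
by rewrite poweRyr// expe2 mulyy.
Qed.

(** * The divergence as an integral, and integrability of the density *)

Section L2.
Context {K : realType} {d : measure_display} {X : measurableType d}.
Variables (Pi : probability X K) (k : K.-pker X ~> X).

Lemma bounded_Lfun2 (f : X -> K) c : measurable_fun setT f ->
  (forall x, `|f x| <= c) -> f \in Lfun Pi 2%:E.
Proof.
move=> mf fc; have Pi1 : Pi setT = 1%E by exact: probability_setT.
rewrite inE; apply/andP; split; rewrite inE//=.
rewrite /finite_norm unlock poweR_lty//.
have : Pi.-integrable setT (EFin \o (fun x => `|f x| `^ 2)).
  apply: (bounded_integrable Pi _ (c `^ 2)) => //.
    by apply: (measurableT_comp (measurable_powR _)); exact: measurableT_comp.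
  move=> x; rewrite ger0_norm ?powR_ge0// ge0_ler_powR ?nnegrE//.
  exact: le_trans (fc x).
by move=> /integrable_lty; apply.
Qed.

(** Since [k] preserves constants, [kop k h - 1] agrees with [kop k (h - 1)] wherever [h - 1] is
    integrable for [k x], that is, almost everywhere. *)
Lemma chi2_integral_sqr (nu : probability X K) (h : X -> K) :
  kernel_reversible Pi k -> has_density nu Pi h ->
  Pi.-integrable setT (EFin \o (fun x => h x - 1)) ->
  chi2 (kact nu k) Pi = (\int[Pi]_x (kop k (fun x => h x - 1) x ^+ 2)%:E)%E.
Proof.
move=> rev hd ig; rewrite (chi2_reversible rev hd) -poweR2_sqre ?Lnorm_ge0//.
rewrite poweR_Lnorm//; have [mh _] := hd.
have mg : measurable_fun setT (fun x => h x - 1).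
  exact: measurable_funB.
apply: ae_eq_integral => //.
- apply/measurable_EFinP; apply: (measurableT_comp (measurable_powR _)).
  apply: measurableT_comp => //; apply: measurable_funB => //.
  exact: measurable_kop.
- by apply/measurable_EFinP; apply: measurable_funX; exact: measurable_kop.
apply: filterS (ae_kernel_integrable Pi k rev _ ig) => x ix _.
rewrite /= powR_mulrn// real_normK ?num_real//; congr ((_ ^+ 2)%:E).
have i1 : (k x).-integrable setT (EFin \o (cst 1 : X -> K)).
  by apply: (bounded_integrable (k x) _ 1) => [||y]; rewrite ?kernel_setT// normr1.
rewrite /kop (_ : Rintegral _ _ h = Rintegral (k x) setT (fun y => (h y - 1) + cst 1 y)).
  by rewrite RintegralD// Rintegral_cst// kernel_setT/= mul1r addrK.
by congr fine; apply: eq_integral => y _; rewrite /= subrK.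
Qed.

Lemma density_Rintegral (nu : probability X K) (h : X -> K) :
  has_density nu Pi h -> \int[Pi]_x h x = 1.
Proof. by move=> [_ H]; rewrite /Rintegral -H// probability_setT. Qed.

Lemma Lnorm_integrable (g : X -> K) s : measurable_fun setT g -> 1 <= s ->
  ('N[Pi]_s%:E [EFin \o g] < +oo)%E -> Pi.-integrable setT (EFin \o g).
Proof.
move=> mg s1 Ns; apply/Lfun1_integrable.
apply: (@Lfun_subset _ _ _ Pi 1 s%:E) => //.
  by apply: fin_num_measure.
by rewrite inE; apply/andP; split; rewrite inE.
Qed.

End L2.

(** * The bound at a fixed time *)

Section chi2_bound.
Context {K : realType} {d : measure_display} {X : borelMetricType d K}.

(** Here [k], [k2], [r] and [s] stand for the kernels at times t and 2t, for R(2t) and for 2p. That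
    t is large enters only through the last hypothesis, which bounds [lipnorm h] when the norm of
    [h - 1] is positive. *)
Lemma chi2_le (Pi nu : probability X K) (k k2 : K.-pker X ~> X)
    (M h : X -> K) (r s : K) :
  kernel_reversible Pi k -> kernel_reversible Pi k2 ->
  (forall f, f \in Lfun Pi 2%:E -> kop k2 f = kop k (kop k f) %[ae Pi]) ->
  measurable_fun setT M -> (forall x, 1 <= M x) ->
  (forall x, bldist (k2 x) Pi <= (M x * r)%:E)%E ->
  0 < r -> 2 <= s -> has_density nu Pi h -> (lipnorm h < +oo)%E ->
  ((0 < 'N[Pi]_s%:E [(fun x => (h x - 1)%:E)])%E ->
   (lipnorm h * (r `^ s^-1)%:E <= 'N[Pi]_s%:E [(fun x => (h x - 1)%:E)])%E) ->
  (chi2 (kact nu k) Pi <=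
     24%:E * (\int[Pi]_x (M x)%:E) `^ (1 - s^-1)
     * (r `^ (1 - 2 * s^-1))%:E
     * 'N[Pi]_s%:E [(fun x => (h x - 1)%:E)] ^+ 2)%E.
Proof.
move=> rev rev2 semi mM M1 bl r0 s2 hd lh lhN; have [mh _] := hd.
have Pi1 : Pi setT = 1%E by exact: probability_setT.
have s1 : 1 <= s by lra.
have s0 : 0 < s by lra.
pose g x := h x - 1.
have mg : measurable_fun setT g by exact: measurable_funB.
have mEM : measurable_fun setT (EFin \o M) by exact/measurable_EFinP.
have M0 x : 0 <= M x by exact: le_trans (M1 x).
have I1 : (1 <= \int[Pi]_x (M x)%:E)%E.
  apply: (@le_trans _ _ (\int[Pi]_x (cst 1 x)))%E.
    by rewrite integral_cst// mul1e [leRHS]Pi1.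
  by apply: ge0_le_integral => // x _; rewrite lee_fin.
have rp : 0 < r `^ (1 - 2 * s^-1) by rewrite powR_gt0.
have Ip : (0 < (\int[Pi]_x (M x)%:E) `^ (1 - s^-1))%E.
  by apply: poweR_gt0; exact: lt_le_trans I1.
set N := Lnorm Pi _ _ in lhN *.
have NJ : (N `^ s = \int[Pi]_x (`|g x| `^ s)%:E)%E.
  by rewrite poweR_Lnorm// gt_eqF.
have : (0 <= N)%E by exact: Lnorm_ge0.
(* If the norm is infinite, so is the right-hand side, its other factors being positive. *)
case EN : N => [N0| |//] N_ge0; last first.
  by rewrite expe2 mulyy gt0_muley ?leey// !mule_gt0 ?lte_fin.
have ig : Pi.-integrable setT (EFin \o g).
  by apply: (Lnorm_integrable Pi _ s) => //; rewrite -/N EN ltry.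
rewrite (chi2_integral_sqr Pi k nu h rev hd ig) -/g.
(* The density has integral 1, so [g] is centred. *)
have g0 : \int[Pi]_x g x = 0.
  have i1 : Pi.-integrable setT (EFin \o (cst 1 : X -> K)).
    by apply: (bounded_integrable Pi _ 1) => // x; rewrite normr1.
  have := density_Rintegral Pi nu h hd.
  rewrite (_ : Rintegral _ _ h = Rintegral Pi setT (fun x => g x + cst 1 x)).
    rewrite RintegralD// Rintegral_cst// [X in fine X]Pi1 mul1r => H.
    by apply/eqP; rewrite -(addrK 1 (Rintegral _ _ _)) H subrr.
  by congr fine; apply: eq_integral => x _; rewrite /= subrK.
have sqr_clamp n : (\int[Pi]_x (kop k (clamp n%:R \o g) x ^+ 2)%:E =
    (\int[Pi]_x (clamp n%:R (g x) * kop k2 (clamp n%:R \o g) x))%R%:E)%E.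
  have cn x : `|(clamp n%:R \o g) x| <= n%:R by exact: norm_clamp_le.
  have mc := measurable_clamp d X n%:R g mg.
  rewrite (integral_sqr_kop Pi k k2 rev _ n%:R)//.
  by apply: semi; exact: bounded_Lfun2 cn.
(* If the norm is 0, then [g] and its truncations vanish almost everywhere, and the limit argument
   applies with all bounds equal to 0. *)
move: N_ge0; rewrite lee_fin le_eqVlt => /predU1P[N00|N_gt0].
  have gae : EFin \o g = \0 %[ae Pi].
    apply: (@Lnorm_eq0_eq0 _ _ _ _ _ s%:E); [|by rewrite lte_fin|].
      exact/measurable_EFinP.
    by rewrite -/N EN -N00.
  apply: (@le_trans _ _ 0%E); last first.
    by rewrite -N00 expe2 mul0e mule0.
  apply: (integral_sqr_kop_le Pi k rev g (fun=> 0) 0 ig); last exact: cvg_cst.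
  apply: nearW => n; rewrite sqr_clamp lee_fin /Rintegral.
  rewrite (ae_eq_integral (cst 0%E))//.
  - by rewrite integral0.
  - apply/measurable_EFinP; apply: measurable_funM; first exact: measurable_clamp.
    by apply: measurable_kop; exact: measurable_clamp.
  - have c00 : clamp n%:R 0 = 0 :> K by rewrite clamp_id ?normr0 ?ler0n.
    by apply: filterS gae => x /(_ I) [gx] _; rewrite gx c00 mul0r.
(* If [M] has infinite integral, the right-hand side is infinite, the exponent [1 - s^-1] being
   positive. *)
case EI : (\int[Pi]_x (M x)%:E)%E I1 => [I | |//]; last first.
  move=> _; rewrite poweRyr; last by rewrite gt_eqF// subr_gt0 invf_lt1//; lra.
  by rewrite gt0_muley// gt0_mulye// gt0_mulye ?leey// expe2 mule_gt0.
rewrite lee_fin => I1.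
pose m := N0 * r `^ (- s^-1); pose c := N0 * (r * I) `^ (- s^-1).
have m0 : 0 < m by rewrite mulr_gt0 ?powR_gt0.
have c0 : 0 < c by rewrite mulr_gt0 ?powR_gt0// mulr_gt0//; lra.
pose B := m `^ (2 - s) * (N0 `^ s + N0 `^ s) +
    2 * m * (c * r * I + c `^ (1 - s) * N0 `^ s).
have lgm : (lipnorm h <= m%:E)%E.
  move: lhN; rewrite EN lte_fin => /(_ N_gt0).
  have := lipnorm_ge0 h; case: (lipnorm h) lh => [l| |]// _ l0.
  rewrite -EFinM !lee_fin /m powRN => lN.
  by rewrite ler_pdivlMr ?powR_gt0.
have HM x : `|kop k2 (clamp m \o g) x - \int[Pi]_y clamp m (g y)| <=
     2 * m * Num.min (M x * r) 1.
  have [l lE] : exists l, lipnorm h = l%:E.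
    exists (fine (lipnorm h)); rewrite fineK// ge0_fin_numE//; exact: lipnorm_ge0.
  apply: (clamp_bldist_le (k2 x) Pi g l) => //.
  - exact: kernel_setT.
  - by rewrite lipnormB lE.
  - by rewrite -lee_fin -lE.
apply: (@le_trans _ _ B%:E); last first.
  rewrite poweR_EFin -EFin_expe -!EFinM lee_fin.
  exact: powR_balance.
apply: (integral_sqr_kop_le Pi k rev g
  (fun n => B + m * `|\int[Pi]_x clamp n%:R (g x)|) B ig).
  near=> n; rewrite sqr_clamp.
  have mn : m <= n%:R by near: n; exact: nbhs_infty_ger.
  have := dirichlet_clamp_le Pi k2 g M m n%:R s r c rev2 mg mM m0 mn s2 (ltW r0) c0 M0 HM.
  by rewrite -NJ EN poweR_EFin EI.
(* The extra term tends to 0 because the integrals of the truncations tend to that of [g], which is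
   0. *)
rewrite -[X in _ --> X]addr0; apply: cvgD; first exact: cvg_cst.
rewrite -[X in _ --> X](mulr0 m); apply: cvgMr.
rewrite -(normr0 K) -g0; apply: cvg_norm; exact: Rintegral_clamp_cvg.
Unshelve. all: by end_near. Qed.

End chi2_bound.

(* The threshold t0 only depends on T, R, p and the spread to fluctuation
   ratio. *)
Theorem mainTheorem2 (K : realType) (T : set K) (R : K -> K) (p : K) :
  is_time_set T ->
  (forall t, T t -> 0 < R t <= 1) ->
  (forall s t, T s -> T t -> s < t -> R t < R s) ->
  R @ within T (pinfty_nbhs K) --> (0 : K) ->
  1 < p ->
  exists t0 : \bar K -> K,
  forall (d : measure_display) (X : borelMetricType d K)
    (P : K -> K.-pker X ~> X) (Pi : probability X K) (M : X -> K),
  transition_kernels T P ->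
  L2_markov_semigroup T P Pi ->
  unique_invariant T P Pi ->
  reversible T P Pi ->
  measurable_fun [set: X] M ->
  (forall x, 1 <= M x) ->
  (forall x t, T t -> (bldist (P t x) Pi <= (M x * R t)%:E)%E) ->
  forall (nu : probability X K) (h : X -> K),
  has_density nu Pi h ->
  (lipnorm h < +oo)%E ->
  forall t, T t -> t0 (sfr Pi (2 * p) h) <= t ->
  (chi2 (kact nu (P t)) Pi <=
     24%:E * (\int[Pi]_x (M x)%:E) `^ (1 - (2 * p)^-1)
     * (R (2 * t) `^ (1 - p^-1))%:E
     * 'N[Pi]_(2 * p)%:E [(fun x => (h x - 1)%:E)] ^+ 2)%E.
Proof.
move=> HT R01 _ R0 p1.
have u0 : 0 < (2 * p)^-1 by rewrite invr_gt0; lra.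
(* One threshold is chosen for every possible value of the ratio, before the process and the density
   are given. *)
have [t0 Ht0] := choice (fun v => rate_threshold T R _ v HT R01 R0 u0).
exists t0 => d X P Pi M _ semi _ rev mM M1 bl nu h hd lh t Tt tt0.
have T2 := time_set_double T t HT Tt; have /andP[R2 _] := R01 _ T2.
have -> : 1 - p^-1 = 1 - 2 * (2 * p)^-1 by field; lra.
have s2 : 2 <= 2 * p by lra.
have semi2 f : f \in Lfun Pi 2%:E -> kop (P (2 * t)) f = kop (P t) (kop (P t) f) %[ae Pi].
  rewrite mulr_natl mulr2n => f2.
  exact: (@L2_semigroupD _ _ _ _ _ _ semi t t f Tt Tt f2).
apply: (chi2_le Pi nu (P t) (P (2 * t)) M h (R (2 * t)) (2 * p) (rev t Tt)
  (rev _ T2) semi2 mM M1 (fun x => bl x _ T2) R2 s2 hd lh).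
set N := Lnorm Pi _ _ => N0.
(* If [lipnorm h] is 0, the required inequality has left side 0. Otherwise [h] is not constant,
   [sfr] is a genuine quotient, and the threshold inequality multiplied by [lipnorm h] is the
   required one. *)
have := lipnorm_ge0 h; rewrite le_eqVlt => /predU1P[<-|l0].
  by rewrite mul0e ltW.
have hc : ~ (exists c, h = cst c).
  move=> [c hc]; move: l0; apply/negP; rewrite -leNgt hc.
  by apply/lipnorm_leP => // x y; rewrite subrr normr0 mul0r.
have := Ht0 (sfr Pi (2 * p) h) t Tt tt0.
rewrite /sfr asboolF// (density_Rintegral Pi nu h hd) -/N.
case: (lipnorm h) lh l0 => [l| |]// _.
rewrite lte_fin => l0; rewrite inver (gt_eqF l0) lee_pdivlMr// => H.
rewrite muleC; apply: H.
by rewrite mule_gt0// lte_fin invr_gt0.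
Qed.
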